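(* For all $\mathfrak s,\mathfrak L,\mathfrak M\in\mathbf{StIP}$, $$\big\langle\mathsf{IPC}(\mathfrak L\bullet\mathfrak M),\mathfrak s\big\rangle=\big\langle\mathsf{IPC}(\mathfrak L)\otimes\mathsf{IPC}(\mathfrak M),\,\Delta_\bullet(\mathfrak s)\big\rangle .$$
   Context: $\mathbb N_{\ge1}=\{1,2,\dots\}$, $[n]=\{1,\dots,n\}$, $[0]=\emptyset$. For a finite set $A\subset\mathbb N_{\ge1}$, an interval partition of $A$ is a finite set $\mathcal I$ of non-empty pairwise disjoint sets (blocks) with union $A$, each block being an interval of $\mathbb N_{\ge1}$ (a set of consecutive integers $\{a,a+1,\dots,b\}$). $\mathbf{IP}(A)$ is the set of these ($\mathbf{IP}(\emptyset)=\{\emptyset\}$), $\mathbf{IP}=\bigcup_A\mathbf{IP}(A)$, and $\bigcup\mathcal I$ denotes the ground set of $\mathcal I$. $\mathbf{StIP}_n:=\mathbf{IP}([n])$, $\mathbf{StIP}:=\bigcup_{n\ge0}\mathbf{StIP}_n$. Order: for $\mathcal I,\mathcal J\in\mathbf{IP}$, $\mathcal I\le\mathcal J$ means $\bigcup\mathcal I=\bigcup\mathcal J$ and every block of $\mathcal I$ is contained in a block of $\mathcal J$. Standardization: for $\mathcal I\in\mathbf{IP}$ with $|\bigcup\mathcal I|=n$, $\mathbf{std}(\mathcal I)\in\mathbf{StIP}_n$ is the image of $\mathcal I$, block by block, under the unique order-preserving bijection $\bigcup\mathcal I\to[n]$. Cliques: for finite $A\subset\mathbb N_{\ge1}$, $\mathbf{cliques}(A)$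 is the set of maximal runs of consecutive integers in $A$. For $\mathcal I\in\mathbf{IP}$, $\mathcal I(A):=\{E\cap c\mid E\in\mathcal I,\ c\in\mathbf{cliques}(A)\}\setminus\{\emptyset\}$, an interval partition of $A\cap\bigcup\mathcal I$. $\mathcal H_{\mathrm{int}}$ is the free $\mathbb Q$-vector space on $\mathbf{StIP}$. For $\mathfrak s=\{\mathfrak s_1,\dots,\mathfrak s_m\}$, $\mathfrak t=\{\mathfrak t_1,\dots,\mathfrak t_n\}$ in $\mathbf{StIP}$, $\mathfrak s\bullet\mathfrak t:=\{\mathfrak s_1,\dots,\mathfrak s_m,\mathfrak t_1',\dots,\mathfrak t_n'\}$ with $\mathfrak t_i':=|\bigcup\mathfrak s|+\mathfrak t_i$ (translate). Its dual coproduct is $\Delta_\bullet(\mathfrak s):=\sum_{\mathfrak a\bullet\mathfrak b=\mathfrak s}\mathfrak a\otimes\mathfrak b$ (sum over $\mathfrak a,\mathfrak b\in\mathbf{StIP}$), extended linearly. Signature: for $\mathfrak L\in\mathbf{StIP}$, $\mathsf{IPC}(\mathfrak L):\mathcal H_{\mathrm{int}}\to\mathbb Q$ is the linear map with $\langle\mathsf{IPC}(\mathfrak L),\mathfrak s\rangle:=\#\{A\subset\bigcup\mathfrak L\mid\mathbf{std}(\mathfrak L(A))\ge\mathfrak s\}$ for $\mathfrak s\in\mathbf{StIP}$; and $\langle f\otimes g,x\otimes y\rangle:=\langle f,x\rangle\langle g,y\rangle$. *)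

(* Defs.v *)
From HB Require Import structures.
From mathcomp Require Import all_boot all_order all_algebra finmap.
From mathcomp Require Import freeg.

Set Implicit Arguments.
Unset Strict Implicit.
Unset Printing Implicit Defensive.

Import Order.TTheory GRing.Theory.

Local Open Scope fset_scope.

Definition itv (a b : nat) : {fset nat} := [fset k in iota a (b.+1 - a)].

Lemma mem_itv a b k : (k \in itv a b) = (a <= k <= b)%N.
Proof.
rewrite !inE /= mem_iota; case: (leqP a k) => //= ak.
case: (leqP a b.+1) => ab; first by rewrite subnKC.
rewrite (eqP (ltnW ab)) addn0 [LHS]ltnNge ak; apply/esym/negbTE.
by rewrite -ltnNge (leq_trans (ltnW ab)).
Qed.

(* The end points are taken in [E] to make this a boolean; see [intervalP]. *)
Definition is_interval (E : {fset nat}) : bool :=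
  [exists a : E, [exists b : E,
     (0 < val a)%N && (E == itv (val a) (val b))]].

Lemma intervalP (E : {fset nat}) :
  reflect (exists a b, [/\ (0 < a)%N, (a <= b)%N & E = itv a b])
          (is_interval E).
Proof.
apply: (iffP existsP) => [[a /existsP[b /andP[a0 /eqP e]]]|[a [b [a0 ab e]]]].
  exists (val a), (val b); split=> //.
  by have := valP a; rewrite /= [X in _ \in X]e mem_itv leqnn.
have aE : a \in E by rewrite e mem_itv leqnn.
have bE : b \in E by rewrite e mem_itv ab leqnn.
by exists [` aE]; apply/existsP; exists [` bE]; rewrite /= a0 e eqxx.
Qed.

Lemma interval_convexP (E : {fset nat}) :
  reflect [/\ E != fset0, 0%N \notin E &
             forall x y z, x \in E -> z \in E -> (x <= y <= z)%N -> y \in E]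
          (is_interval E).
Proof.
apply: (iffP (intervalP E)) => [[a [b [a0 ab ->]]]|[E0 zE cE]].
  split.
  - by apply/fset0Pn; exists a; rewrite mem_itv leqnn.
  - by rewrite mem_itv leqNgt a0.
  - move=> x y z; rewrite !mem_itv => /andP[ax _] /andP[_ zb] /andP[xy yz].
    by rewrite (leq_trans ax xy) (leq_trans yz zb).
have [x xE] := fset0Pn _ E0.
case: (@arg_minnP E [` xE] predT val isT) => a _ amin.
case: (@arg_maxnP E [` xE] predT val isT) => b _ bmax.
exists (val a), (val b); split.
- by rewrite lt0n; apply: contraNneq zE => <-; apply: valP.
- exact: amin.
- apply/fsetP => k; rewrite mem_itv; apply/idP/idP => [kE|].
    by apply/andP; split; [apply: (amin [` kE])|apply: (bmax [` kE])].
  by apply: cE; apply: valP.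
Qed.

(* The elements of [cliques A] avoid 0; only sets [A] of positive integers are
   relevant. *)
Definition cliques (A : {fset nat}) : {fset {fset nat}} :=
  [fset c in fpowerset A | is_interval c &
     [forall d : fpowerset A,
        is_interval (val d) && (c `<=` val d) ==> (val d == c)]].

Lemma cliquesP (A c : {fset nat}) :
  reflect [/\ c `<=` A, is_interval c &
             forall d : {fset nat},
               d `<=` A -> is_interval d -> c `<=` d -> d = c]
          (c \in cliques A).
Proof.
rewrite !inE /= fpowersetE.
apply: (iffP and3P) => -[cA ci cm]; split=> //.
  move=> d dA di cd; have dP : d \in fpowerset A by rewrite fpowersetE.
  by move/forallP: cm => /(_ [` dP]); rewrite /= di cd => /eqP.
apply/forallP => d; apply/implyP => /andP[di cd]; apply/eqP/cm => //.
by rewrite -fpowersetE; apply: valP.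
Qed.

Lemma cliques_disjoint (A c d : {fset nat}) x :
  c \in cliques A -> d \in cliques A -> x \in c -> x \in d -> c = d.
Proof.
move=> /cliquesP[cA ci cm] /cliquesP[dA di dm] xc xd.
have uA : c `|` d `<=` A by rewrite fsubUset cA.
have ui : is_interval (c `|` d).
  have [c0 zc cc] := interval_convexP _ ci.
  have [d0 zd cd] := interval_convexP _ di.
  apply/interval_convexP; split.
  - by apply/fset0Pn; exists x; rewrite inE xc.
  - by rewrite inE negb_or zc zd.
  - have key (e f : {fset nat}) u v y : x \in e -> x \in f ->
        (forall x y z, x \in e -> z \in e -> (x <= y <= z)%N -> y \in e) ->
        (forall x y z, x \in f -> z \in f -> (x <= y <= z)%N -> y \in f) ->
        u \in e -> v \in f -> (u <= y <= v)%N -> (y \in e) || (y \in f).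
      move=> xe xf ce cf ue vf /andP[uy yv]; case: (leqP y x) => yx.
        by rewrite (ce u y x) ?uy ?yx.
      by rewrite (cf x y v) ?orbT // (ltnW yx) yv.
    move=> u y v; rewrite !inE => /orP[uc|ud] /orP[vc|vd] uyv.
    + by rewrite (cc u y v).
    + exact: (key c d u v).
    + by rewrite orbC; apply: (key d c u v).
    + by rewrite (cd u y v) ?orbT.
by have := cm _ uA ui (fsubsetUl c d); rewrite (dm _ uA ui (fsubsetUr c d)).
Qed.

Lemma mem_cover_cliques (A : {fset nat}) x :
  0%N \notin A -> (x \in fcover (cliques A)) = (x \in A).
Proof.
move=> A0; apply/bigfcupP/idP => [[c /andP[/cliquesP[cA _ _] _]]|xA].
  exact: (fsubsetP cA).
have sA : [fset x] `<=` A by rewrite fsub1set.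
have sP : [fset x] \in fpowerset A by rewrite fpowersetE.
have x0 : (0 < x)%N by rewrite lt0n; apply: contraNneq A0 => <-.
have si : is_interval [fset x].
  apply/intervalP; exists x, x; split=> //.
  by apply/fsetP => k; rewrite mem_itv !inE eqn_leq andbC.
pose P (c : fpowerset A) := is_interval (val c) && (x \in val c).
have Ps : P [` sP] by rewrite /P /= si inE eqxx.
case: (@arg_maxnP _ [` sP] P (fun c => #|` val c|) Ps) => c /andP[ci xc] cm.
exists (val c); rewrite ?andbT //; apply/cliquesP; split=> //.
  by rewrite -fpowersetE; apply: valP.
move=> d dA di cd; have dP : d \in fpowerset A by rewrite fpowersetE.
apply/esym/eqP; rewrite eqEfcard cd /=.
by apply: (cm [` dP]); rewrite /P /= di (fsubsetP cd).
Qed.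

Definition is_ip (I : {fset {fset nat}}) : bool :=
  [forall E : I, is_interval (val E)] && trivIfset I.

Lemma is_ipP (I : {fset {fset nat}}) :
  reflect ((forall E, E \in I -> is_interval E) /\
           (forall E F x, E \in I -> F \in I -> x \in E -> x \in F -> E = F))
          (is_ip I).
Proof.
apply: (iffP andP) => -[iI tI]; split.
- by move=> E EI; apply: (forallP iI [` EI]).
- move=> E F x EI FI xE xF; apply/eqP/negPn/negP => EF.
  have /fdisjointP/(_ _ xE) := trivIfsetP _ tI E F EI FI EF.
  by rewrite xF.
- by apply/forallP => E; apply: iI; apply: valP.
- apply/trivIfsetP => E F EI FI EF; apply/fdisjointP => x xE.
  by apply: contra EF => xF; apply/eqP/(tI _ _ x).
Qed.

Record ip : Type := IP { blocks :> {fset {fset nat}}; _ : is_ip blocks }.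
HB.instance Definition _ := [isSub for blocks].
HB.instance Definition _ := [Choice of ip by <:].

Definition ground (I : {fset {fset nat}}) : {fset nat} := fcover I.

Lemma mem_ground (I : {fset {fset nat}}) x :
  reflect (exists2 E, E \in I & x \in E) (x \in ground I).
Proof.
apply: (iffP (bigfcupP _ _ _ _)) => -[E EI xE]; exists E => //.
  by case/andP: EI.
by rewrite EI.
Qed.

Lemma ground_gt0 (I : ip) x : x \in ground I -> (0 < x)%N.
Proof.
case/mem_ground => E EI xE; have [iI _] := is_ipP _ (valP I).
have [_ E0 _] := interval_convexP _ (iI _ EI).
by rewrite lt0n; apply: contraNneq E0 => <-.
Qed.

(* [itv 1 n] is the set [n]; the size n is determined by the partition. *)
Definition is_std (I : ip) : bool := ground I == itv 1 #|` ground I|.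

Record stip : Type := StIP { ip_of :> ip; _ : is_std ip_of }.
HB.instance Definition _ := [isSub for ip_of].
HB.instance Definition _ := [Choice of stip by <:].

Definition ip_le (I J : ip) : bool :=
  (ground I == ground J) && [forall E : I, [exists F : J, val E `<=` val F]].

Definition rank (A : {fset nat}) (x : nat) : nat := #|` [fset y in A | y <= x]%N|.

Lemma card_itv a b : #|` itv a b| = (b.+1 - a)%N.
Proof. by rewrite /itv card_fseq undup_id ?iota_uniq // size_iota. Qed.

Lemma rank_mono (A : {fset nat}) :
  {in A &, {mono rank A : x y / (x <= y)%N >-> (x <= y)%N}}.
Proof.
have lt x y : y \in A -> (x < y)%N -> (rank A x < rank A y)%N.
  move=> yA xy; apply: fproper_ltn_card; rewrite fproperE; apply/andP; split.
    apply/fsubsetP => k; rewrite !inE /= => /andP[-> kx].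
    by rewrite (leq_trans kx (ltnW xy)).
  by apply/fsubsetPn; exists y; rewrite !inE /= yA /= ?leqnn // -ltnNge.
move=> x y xA yA; case: (ltngtP x y) => [xy|yx|->]; rewrite ?leqnn //.
  exact/ltnW/lt.
by apply/negbTE; rewrite -ltnNge; apply: lt.
Qed.

Lemma rank_inj (A : {fset nat}) : {in A &, injective (rank A)}.
Proof.
move=> x y xA yA e; apply/eqP; rewrite eqn_leq.
by rewrite -(rank_mono xA yA) -(rank_mono yA xA) e leqnn.
Qed.

Lemma rank_image (A : {fset nat}) : rank A @` A = itv 1 #|` A|.
Proof.
apply/eqP; rewrite eqEfcard; apply/andP; split; last first.
  by rewrite card_itv subn1 card_in_imfset //; apply: rank_inj.
apply/fsubsetP => _ /imfsetP[x /= xA ->]; rewrite mem_itv.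
rewrite /rank cardfs_gt0; apply/andP; split.
  by apply/fset0Pn; exists x; rewrite !inE /= xA leqnn.
by apply: fsubset_leq_card; apply/fsubsetP => y; rewrite !inE => /andP[].
Qed.

(* [rank A] is the unique order-preserving bijection from [A] to [n]. *)
Lemma rank_uniq (A : {fset nat}) (f : nat -> nat) :
  {in A &, {mono f : x y / (x <= y)%N >-> (x <= y)%N}} ->
  f @` A = itv 1 #|` A| -> {in A, f =1 rank A}.
Proof.
move=> fm fA x xA.
have fi : {in A &, injective f}.
  move=> u v uA vA e; apply/eqP; rewrite eqn_leq.
  by rewrite -(fm _ _ uA vA) -(fm _ _ vA uA) e leqnn.
have fxA : f x \in itv 1 #|` A| by rewrite -fA in_imfset.
have -> : f x = #|` itv 1 (f x)| by rewrite card_itv subn1.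
rewrite /rank.
have -> : itv 1 (f x) = f @` [fset y in A | (y <= x)%N].
  apply/fsetP => k; apply/idP/imfsetP => /= [|[y]].
    rewrite mem_itv => /andP[k1 kx].
    have : k \in f @` A.
      rewrite fA mem_itv k1 (leq_trans kx) //.
      by move: fxA; rewrite mem_itv => /andP[].
    case/imfsetP => y /= yA ky; exists y => //.
    by rewrite !inE /= yA -(fm _ _ yA xA) -ky.
  rewrite mem_itv !inE /= => /andP[yA yx] ->; rewrite fm // yx andbT.
  have : f y \in itv 1 #|` A| by rewrite -fA in_imfset.
  by rewrite mem_itv => /andP[].
rewrite card_in_imfset // => u v.
by rewrite !inE /= => /andP[uA _] /andP[vA _]; apply: fi.
Qed.

Definition std_blocks (I : {fset {fset nat}}) : {fset {fset nat}} :=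
  [fset rank (ground I) @` E | E : {fset nat} in I].

Lemma ground_std_blocks (I : {fset {fset nat}}) :
  ground (std_blocks I) = itv 1 #|` ground I|.
Proof.
rewrite -rank_image; apply/fsetP => x; apply/mem_ground/imfsetP => /=.
  case=> _ /imfsetP[E /= EI ->] /imfsetP[y /= yE ->]; exists y => //.
  by apply/mem_ground; exists E.
case=> y /mem_ground[E EI yE] ->.
by exists (rank (ground I) @` E); apply: in_imfset.
Qed.

Lemma std_is_ip (I : ip) : is_ip (std_blocks I).
Proof.
have [iI dI] := is_ipP _ (valP I).
have gI E y : E \in blocks I -> y \in E -> y \in ground I.
  by move=> EI yE; apply/mem_ground; exists E.
apply/is_ipP; split.
  move=> _ /imfsetP[E /= EI ->]; have [E0 _ cE] := interval_convexP _ (iI _ EI).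
  have rE y : y \in E -> rank (ground I) y \in itv 1 #|` ground I|.
    by move=> yE; rewrite -rank_image in_imfset //= (gI E).
  apply/interval_convexP; split.
  - have [x xE] := fset0Pn _ E0.
    by apply/fset0Pn; exists (rank (ground I) x); apply: in_imfset.
  - by apply/imfsetP => -[y /= yE e]; have := rE _ yE; rewrite -e mem_itv.
  - move=> _ y _ /imfsetP[u /= uE ->] /imfsetP[v /= vE ->] /andP[uy yv].
    have : y \in rank (ground I) @` ground I.
      rewrite rank_image mem_itv; move: (rE _ uE) (rE _ vE); rewrite !mem_itv.
      by move=> /andP[u1 _] /andP[_ vn]; rewrite (leq_trans u1 uy) (leq_trans yv vn).
    case/imfsetP => w /= wg yw; move: uy yv; rewrite yw.
    rewrite !rank_mono ?wg ?(gI E) // => uw wv.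
    by apply: in_imfset; apply: (cE u w v); rewrite ?uw.
move=> _ _ x /imfsetP[E /= EI ->] /imfsetP[F /= FI ->].
move=> /imfsetP[y /= yE ->] /imfsetP[z /= zF] /rank_inj e.
have {}e : y = z by apply: e; [apply: (gI E)|apply: (gI F)].
by rewrite (dI E F y) // e.
Qed.

Definition std_ip (I : ip) : ip := IP (std_is_ip I).

Lemma std_is_std (I : ip) : is_std (std_ip I).
Proof. by rewrite /is_std /= ground_std_blocks card_itv subn1. Qed.

Definition std (I : ip) : stip := StIP (std_is_std I).

Definition restr_blocks (I : {fset {fset nat}}) (A : {fset nat}) :
    {fset {fset nat}} :=
  [fset E `&` c | E in I, c in cliques A] `\ fset0.

Lemma restr_is_ip (I : ip) (A : {fset nat}) : is_ip (restr_blocks I A).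
Proof.
have [iI dI] := is_ipP _ (valP I).
apply/is_ipP; split.
  move=> B /fsetD1P[ne /imfset2P[E /= EI [c /= cA eB]]].
  rewrite {B}eB in ne *.
  have [_ ci _] := cliquesP _ _ cA.
  have [_ E0 cE] := interval_convexP _ (iI _ EI).
  have [_ _ cc] := interval_convexP _ ci.
  apply/interval_convexP; split=> //; first by rewrite inE (negbTE E0).
  move=> x y z; rewrite !inE => /andP[xE xc] /andP[zE zc] xyz.
  by rewrite (cE x y z) // (cc x y z).
move=> B C x /fsetD1P[_ /imfset2P[E /= EI [c /= cA eB]]].
move=> /fsetD1P[_ /imfset2P[F /= FI [d /= dA eC]]]; rewrite {B}eB {C}eC.
rewrite !inE => /andP[xE xc] /andP[xF xd].
by rewrite (dI E F x) // (cliques_disjoint cA dA xc xd).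
Qed.

Definition restr (I : ip) (A : {fset nat}) : ip := IP (restr_is_ip I A).

Lemma ground_restr (I : ip) (A : {fset nat}) :
  0%N \notin A -> ground (restr I A) = A `&` ground I.
Proof.
move=> A0; apply/fsetP => x; rewrite inE; apply/mem_ground/andP => /=.
  case=> _ /fsetD1P[_ /imfset2P[E /= EI [c /= cA ->]]].
  rewrite inE => /andP[xE xc]; split; last by apply/mem_ground; exists E.
  by have [/fsubsetP-> //] := cliquesP _ _ cA.
case; rewrite -(mem_cover_cliques x A0) => /mem_ground[c cA xc] /mem_ground[E EI xE].
have xEc : x \in E `&` c by rewrite inE xE.
exists (E `&` c) => //; apply/fsetD1P; split.
  by apply/fset0Pn; exists x.
by apply/imfset2P; exists E => //; exists c.
Qed.

Definition translate (n : nat) (E : {fset nat}) : {fset nat} :=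
  [fset (n + x)%N | x in E].

Definition bullet_blocks (s t : {fset {fset nat}}) : {fset {fset nat}} :=
  s `|` [fset translate #|` ground s| E | E in t].

Lemma ground_bullet_blocks (s t : {fset {fset nat}}) :
  ground (bullet_blocks s t) = ground s `|` translate #|` ground s| (ground t).
Proof.
apply/fsetP => x; rewrite inE; apply/mem_ground/orP.
  case=> F; rewrite inE => /orP[Fs|/imfsetP[E /= Et ->]] xF.
    by left; apply/mem_ground; exists F.
  right; case/imfsetP: xF => y /= yE ->; apply: in_imfset => /=.
  by apply/mem_ground; exists E.
case=> [/mem_ground[F Fs xF]|/imfsetP[y /= /mem_ground[E Et yE] ->]].
  by exists F; rewrite // inE Fs.
exists (translate #|` ground s| E); last exact: in_imfset.
by rewrite inE in_imfset ?orbT.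
Qed.

Lemma ground_stip (s : stip) : ground s = itv 1 #|` ground s|.
Proof. exact/eqP/(valP s). Qed.

Lemma translate_itv n m : translate n (itv 1 m) = itv n.+1 (n + m).
Proof.
apply/fsetP => k; rewrite mem_itv; apply/imfsetP/idP => /= [[x]|/andP[nk km]].
  by rewrite mem_itv => /andP[x1 xm] ->; rewrite leq_add2l xm andbT -addn1 leq_add2l.
exists (k - n)%N; last by rewrite subnKC // ltnW.
by rewrite mem_itv subn_gt0 nk leq_subLR.
Qed.

Lemma ground_bullet (s t : stip) :
  ground (bullet_blocks s t) = itv 1 (#|` ground s| + #|` ground t|).
Proof.
rewrite ground_bullet_blocks {1}ground_stip [ground t]ground_stip translate_itv.
rewrite card_itv subn1 /=; apply/fsetP => k; rewrite inE !mem_itv.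
case: (leqP k #|` ground s|) => ks; last first.
  by rewrite andbF (leq_trans (ltn0Sn _) ks).
by rewrite orbF (leq_trans ks (leq_addr _ _)).
Qed.

Lemma bullet_is_ip (s t : stip) : is_ip (bullet_blocks s t).
Proof.
have [is_ ds] := is_ipP _ (valP (ip_of s)).
have [it dt] := is_ipP _ (valP (ip_of t)).
set n := #|` ground s|.
have sP E x : E \in blocks s -> x \in E -> (x <= n)%N.
  move=> Es xE; have : x \in ground s by apply/mem_ground; exists E.
  by rewrite ground_stip mem_itv => /andP[].
have tP E x : E \in blocks t -> x \in translate n E -> (n < x)%N.
  move=> Et /imfsetP[y /= yE ->]; have [_ E0 _] := interval_convexP _ (it _ Et).
  rewrite -[X in (X < _)%N]addn0 ltn_add2l lt0n.
  by apply: contraNneq E0 => <-.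
apply/is_ipP; split.
  move=> F; rewrite inE => /orP[/is_ //|/imfsetP[E /= /it/intervalP[a [b [a0 ab ->]]] ->]].
  apply/intervalP; exists (n + a)%N, (n + b)%N; split.
  - by rewrite addn_gt0 a0 orbT.
  - by rewrite leq_add2l.
  - apply/fsetP => k; rewrite mem_itv; apply/imfsetP/andP => /= [[x]|[ak kb]].
      by rewrite mem_itv => /andP[ax xb] ->; rewrite !leq_add2l.
    have nk : (n <= k)%N := leq_trans (leq_addr _ _) ak.
    exists (k - n)%N; last by rewrite subnKC.
    by rewrite mem_itv leq_subLR kb andbT -(leq_add2l n) subnKC.
move=> E F x; rewrite !inE.
case/orP=> [Es|/imfsetP[E' /= Et ->]]; case/orP=> [Fs|/imfsetP[F' /= Ft ->]] xE xF.
- exact: (ds _ _ x).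
- by have := tP _ _ Ft xF; rewrite ltnNge (sP _ _ Es xE).
- by have := tP _ _ Et xE; rewrite ltnNge (sP _ _ Fs xF).
- case/imfsetP: xE => y /= yE xy; case/imfsetP: xF => z /= zF.
  rewrite xy => /addnI e.
  by rewrite (dt E' F' y) // e.
Qed.

Definition bullet_ip (s t : stip) : ip := IP (bullet_is_ip s t).

Lemma bullet_is_std (s t : stip) : is_std (bullet_ip s t).
Proof. by rewrite /is_std /= ground_bullet card_itv subn1. Qed.

Definition bullet (s t : stip) : stip := StIP (bullet_is_std s t).

(* The standard interval partitions of [m] for m <= n, as a finite set, and
   the finite set of pairs (a, b) with [bullet a b = s]; see
   [mem_bullet_fiber]. *)
Definition stips_upto (n : nat) : {fset stip} :=
  [fset t in pmap (fun I => obind (insub : ip -> option stip) (insub I))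
                  (fpowerset (fpowerset (itv 1 n)))].

Lemma mem_stips_upto n (t : stip) :
  (t \in stips_upto n) = (ground t `<=` itv 1 n).
Proof.
rewrite !inE /= mem_pmap; apply/mapP/fsubsetP => [[I]|sub].
  rewrite fpowersetE => /fsubsetP sI; case: insubP => //= J _ eJ.
  case: insubP => //= t' _ et' [->] x; rewrite et' eJ => /mem_ground[E EI xE].
  by move: (sI _ EI); rewrite fpowersetE => /fsubsetP; apply.
exists (blocks t); last by rewrite valK /= valK.
rewrite fpowersetE; apply/fsubsetP => E Et; rewrite fpowersetE.
by apply/fsubsetP => x xE; apply: sub; apply/mem_ground; exists E.
Qed.

Definition bullet_fiber (s : stip) : {fset stip * stip} :=
  let S := stips_upto #|` ground s| in
  [fset p in S `*` S | bullet p.1 p.2 == s].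

Lemma mem_bullet_fiber (s a b : stip) :
  ((a, b) \in bullet_fiber s) = (bullet a b == s).
Proof.
rewrite /bullet_fiber in_fset inE /= in_fsetM /= andbC; case: eqP => //= <-.
rewrite !mem_stips_upto /= ground_bullet card_itv subn1 /=.
rewrite [ground a]ground_stip [ground b]ground_stip !card_itv !subn1 /=.
by apply/andP; split; apply/fsubsetP => x; rewrite !mem_itv => /andP[-> /leq_trans->//];
  rewrite ?leq_addr ?leq_addl.
Qed.

Local Open Scope ring_scope.

Section FreeModule.
Variables (R : nzRingType) (K : choiceType) (M : lmodType R) (f : K -> M).

HB.instance Definition _ :=
  GRing.isZmodMorphism.Build {freeg K / R} M (fglift f) (lift_is_additive f).

Lemma fgliftE (x : {freeg K / R}) :
  fglift f x = \sum_(k <- dom x) coeff k x *: f k.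
Proof.
rewrite -[in LHS](freeg_sumE x) raddf_sum /=.
by apply: eq_bigr => k _; rewrite liftU.
Qed.

Lemma fglift_is_scalable : scalable (fglift f : {freeg K / R} -> M).
Proof.
move=> a x.
have -> : a *: x = \sum_(k <- dom x) << a * coeff k x *g k >> by [].
rewrite -[X in _ = _ *: fglift f X](freeg_sumE x) !raddf_sum /=.
by apply: eq_bigr => k _; rewrite !liftU scalerA.
Qed.

HB.instance Definition _ :=
  GRing.isScalable.Build R {freeg K / R} M *:%R (fglift f) fglift_is_scalable.

End FreeModule.

(* The free vector space on [stip], and its tensor square, realized as the
   free vector space on pairs of basis elements. *)
Definition Hint : lmodType rat := {freeg stip / rat}.
Definition Hint2 : lmodType rat := {freeg (stip * stip)%type / rat}.

Definition tensor (x y : Hint) : Hint2 :=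
  fglift (fun a => fglift (fun b => << (a, b) >> : Hint2) y) x.

Definition functional_tensor (f g : {linear Hint -> rat^o}) :
    {linear Hint2 -> rat^o} :=
  fglift (fun p => f << p.1 >> * g << p.2 >> : rat^o).

Lemma functional_tensorE (f g : {linear Hint -> rat^o}) (x y : Hint) :
  functional_tensor f g (tensor x y) = f x * g y.
Proof.
have lin (h : {linear Hint -> rat^o}) z :
    h z = \sum_(k <- dom z) coeff k z * h << k >>.
  rewrite -[in LHS](freeg_sumE z) linear_sum; apply: eq_bigr => k _.
  have -> : << coeff k z *g k >> = coeff k z *: (<< k >> : Hint).
    by apply/eqP/freeg_eqP => m; rewrite coeffZ !coeffU mul1r.
  exact: linearZ.
rewrite /tensor fgliftE linear_sum (lin f) mulr_suml; apply: eq_bigr => a _.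
rewrite linearZ /= (fgliftE _ y) raddf_sum (lin g) mulr_sumr scaler_sumr.
apply: eq_bigr => b _; rewrite /= fglift_is_scalable liftU scale1r /=.
by rewrite [LHS]mulrA mulrACA mulrA.
Qed.

Definition coproduct : {linear Hint -> Hint2} :=
  fglift (fun s => \sum_(p <- bullet_fiber s) tensor << p.1 >> << p.2 >>).

Definition IPC (L : stip) : {linear Hint -> rat^o} :=
  fglift (fun s : stip =>
    #|` [fset A in fpowerset (ground L) | ip_le s (std (restr L A))]|%:R : rat^o).

(* Main.v *)
(* Subsets of the ground set of [bullet L M] are the disjoint unions of a subset
   A of [ground L] and a translated subset B of [ground M], and the standardized
   restriction to such a set is [bullet u v], where u and v are the standardized
   restrictions of L to A and of M to B.  An interval partition s lies below
   [bullet u v] iff s = [bullet a b] with a below u and b below v; such a pair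
   (a, b) is unique, because the size of a is that of u.  Counting the pairs
   (A, B) by their (a, b) gives the formula.
   An interval partition is determined by its "same block" relation, and all
   constructions are compared through that relation. *)
Require Import Defs.
From mathcomp Require Import all_boot all_order all_algebra finmap.
From mathcomp Require Import freeg.
From mathcomp Require Import zify.

Set Implicit Arguments.
Unset Strict Implicit.
Unset Printing Implicit Defensive.

Import GRing.Theory.

Local Open Scope fset_scope.

(** * The same-block relation as a complete invariant *)

Definition same_block (I : {fset {fset nat}}) (x y : nat) : bool :=
  has (fun E : {fset nat} => (x \in E) && (y \in E)) I.

Lemma same_blockP (I : {fset {fset nat}}) x y :
  reflect (exists E, [/\ E \in I, x \in E & y \in E]) (same_block I x y).
Proof.
apply: (iffP hasP) => [[E EI /andP[xE yE]]|[E [EI xE yE]]]; exists E => //.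
by rewrite xE.
Qed.

Lemma same_block_refl (I : {fset {fset nat}}) x :
  same_block I x x = (x \in ground I).
Proof.
apply/same_blockP/mem_ground => [[E [EI xE _]]|[E EI xE]]; by exists E.
Qed.

Lemma same_block_ground (I : {fset {fset nat}}) x y :
  same_block I x y -> (x \in ground I) /\ (y \in ground I).
Proof. by case/same_blockP => E [EI xE yE]; split; apply/mem_ground; exists E. Qed.

Lemma same_block_gt0 (I : ip) x y :
  same_block I x y -> (0 < x)%N /\ (0 < y)%N.
Proof. by case/same_block_ground => /ground_gt0 ? /ground_gt0. Qed.

(** A block of [I] is non-empty, and the block of [J] through one of its points contains all the
    others, because distinct blocks of [J] are disjoint. *)
Lemma ip_leP (I J : ip) :
  reflect (ground I = ground J /\
           forall x y, same_block I x y -> same_block J x y) (ip_le I J).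
Proof.
apply: (iffP andP) => -[].
  move=> /eqP eg /forallP H; split=> // x y /same_blockP[E [EI xE yE]].
  have /existsP[F /fsubsetP EF] := H [` EI].
  by apply/same_blockP; exists (val F); split; [apply: valP|apply: EF..].
move=> eg H; split; first by rewrite eg.
apply/forallP => E; have [iI _] := is_ipP _ (valP I).
have [_ dJ] := is_ipP _ (valP J).
have [E0 _ _] := interval_convexP _ (iI _ (valP E)).
have [x xE] := fset0Pn _ E0.
have /mem_ground[F FJ xF] : x \in ground J.
  by rewrite -eg; apply/mem_ground; exists (val E) => //; apply: valP.
apply/existsP; exists [` FJ]; apply/fsubsetP => y yE.
have /same_blockP[F' [F'J xF' yF']] : same_block J x y.
  by apply: H; apply/same_blockP; exists (val E); split=> //; apply: valP.
by rewrite /= (dJ F F' x).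
Qed.

(** A block [E] lies in some [F] of the other partition, and [F] lies in some [E'] of the first.
    Since [E] and [E'] meet, they coincide, and [F] is squeezed between them. *)
Lemma ip_le_anti (I J : ip) : ip_le I J -> ip_le J I -> I = J.
Proof.
suff key (I' J' : ip) E : ip_le I' J' -> ip_le J' I' -> E \in blocks I' ->
    E \in blocks J'.
  by move=> IJ JI; apply/val_inj/fsetP => E; apply/idP/idP; apply: key.
move=> /andP[_ /forallP IJ] /andP[_ /forallP JI] EI.
have /existsP[F EF] := IJ [` EI]; have /existsP[E' FE'] := JI F.
have [iI dI] := is_ipP _ (valP I').
have [/fset0Pn[x xE] _ _] := interval_convexP _ (iI _ EI).
have eE : E = val E'.
  apply: (dI _ _ x) => //; first exact: valP.
  by apply: (fsubsetP FE'); apply: (fsubsetP EF).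
have -> : E = val F by apply/eqP; rewrite eqEfsubset EF eE FE'.
exact: valP.
Qed.

Lemma same_block_inj (I J : ip) :
  (forall x y, same_block I x y = same_block J x y) -> I = J.
Proof.
move=> H; have g : ground I = ground J.
  by apply/fsetP => x; rewrite -!same_block_refl.
by apply: ip_le_anti; apply/ip_leP; split=> // x y; rewrite H.
Qed.

(** * Restriction and standardization through same blocks *)

(** Among the intervals in [A] that contain [d], one of largest cardinality is maximal for
    inclusion. *)
Lemma interval_sub_clique (A d : {fset nat}) :
  is_interval d -> d `<=` A -> exists2 c, c \in cliques A & d `<=` c.
Proof.
move=> di dA; have dP : d \in fpowerset A by rewrite fpowersetE.
pose P (c : fpowerset A) := is_interval (val c) && (d `<=` val c).
have Pd : P [` dP] by rewrite /P /= di fsubset_refl.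
case: (@arg_maxnP _ [` dP] P (fun c => #|` val c|) Pd) => c /andP[ci dc] cm.
exists (val c) => //; apply/cliquesP; split=> //.
  by rewrite -fpowersetE; apply: valP.
move=> e eA ei ce; have eP : e \in fpowerset A by rewrite fpowersetE.
apply/esym/eqP; rewrite eqEfcard ce /=.
by apply: (cm [` eP]); rewrite /P /= ei (fsubset_trans dc).
Qed.

(** Two points share a clique of [A] exactly when [A] contains everything between them; this removes
    cliques from the later arguments. The disjunction covers both orders of [x] and [y]. *)
Lemma same_block_restr (I : ip) (A : {fset nat}) x y :
  same_block (restr I A) x y <->
  same_block I x y /\
  forall z, (x <= z <= y)%N || (y <= z <= x)%N -> z \in A.
Proof.
split.
  case/same_blockP => /= _ [/fsetD1P[_ /imfset2P[E /= EI [c /= cA ->]]]].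
  rewrite !inE => /andP[xE xc] /andP[yE yc].
  have [/fsubsetP sA ci _] := cliquesP _ _ cA.
  have [_ _ cc] := interval_convexP _ ci.
  split; first by apply/same_blockP; exists E.
  by move=> z /orP[] zz; apply/sA; [apply: (cc x z y)|apply: (cc y z x)].
case=> sI H; have [x0 y0] := same_block_gt0 sI.
(* The interval spanned by the two points lies in [A], hence in a single clique. *)
have [//||c cA /fsubsetP sc] := @interval_sub_clique A (itv (minn x y) (maxn x y)).
- by apply/intervalP; exists (minn x y), (maxn x y); split=> //; lia.
- by apply/fsubsetP => z; rewrite mem_itv => zz; apply: H; lia.
have [E [EI xE yE]] := same_blockP _ _ _ sI.
have xc : x \in c by apply: sc; rewrite mem_itv; lia.
have yc : y \in c by apply: sc; rewrite mem_itv; lia.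
have xEc : x \in E `&` c by rewrite inE xE.
apply/same_blockP; exists (E `&` c); split=> //=; last by rewrite inE yE.
apply/fsetD1P; split; first by apply/fset0Pn; exists x.
by apply/imfset2P; exists E => //; exists c.
Qed.

Lemma same_block_std (I : ip) :
  {in ground I &, forall x y,
    same_block (std I) (rank (ground I) x) (rank (ground I) y)
    = same_block I x y}.
Proof.
move=> x y xI yI; apply/same_blockP/same_blockP; last first.
  case=> E [EI xE yE]; exists (rank (ground I) @` E).
  by split; apply: in_imfset.
case=> _ [/imfsetP[E /= EI ->] /imfsetP[u /= uE xu] /imfsetP[v /= vE yv]].
have [uI vI] : u \in ground I /\ v \in ground I.
  by split; apply/mem_ground; exists E.
by exists E; rewrite (rank_inj xI uI xu) (rank_inj yI vI yv).
Qed.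

(** By uniqueness of the order-preserving bijection, [f] agrees with [rank] on the ground set, so a
    standardization can be identified through any convenient formula for that bijection. *)
Lemma std_eq (I : ip) (t : stip) (f : nat -> nat) :
  {in ground I &, {mono f : x y / (x <= y)%N >-> (x <= y)%N}} ->
  ground t = f @` ground I ->
  {in ground I &, forall x y, same_block t (f x) (f y) = same_block I x y} ->
  std I = t.
Proof.
move=> fm fg fs.
have fi : {in ground I &, injective f}.
  move=> u v uA vA e; apply/eqP; rewrite eqn_leq.
  by rewrite -(fm _ _ uA vA) -(fm _ _ vA uA) e leqnn.
have fr : {in ground I, f =1 rank (ground I)}.
  by apply: rank_uniq => //; rewrite -fg ground_stip fg card_in_imfset.
have gs : ground (std I) = ground t.
  by rewrite fg ground_std_blocks -rank_image; apply/fsetP => x;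
    apply/imfsetP/imfsetP => -[y /= yI ->]; exists y => //; rewrite fr.
apply/val_inj/same_block_inj => x y.
have [/andP[]|] := boolP ((x \in ground t) && (y \in ground t)).
  rewrite fg => /imfsetP[u /= uI ->] /imfsetP[v /= vI ->].
  by rewrite fs // !fr // same_block_std.
(* Outside the common ground set both relations are false. *)
move=> H; transitivity false; [rewrite -gs in H|symmetry];
  by apply: contraNF H => /same_block_ground[-> ->].
Qed.

(** * Order and cancellation for joined partitions *)

(** Truncated subtraction is harmless here: for [x <= n] it returns 0, which lies in no block. *)
Lemma same_block_bullet (s t : stip) x y :
  let n := #|` ground s| in
  same_block (bullet s t) x y = same_block s x y || same_block t (x - n) (y - n).
Proof.
move=> n; apply/same_blockP/orP.
  case=> F [/fsetUP[Fs|/imfsetP[E /= Et ->]] xF yF].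
    by left; apply/same_blockP; exists F.
  right; case/imfsetP: xF => u /= uE ->; case/imfsetP: yF => v /= vE ->.
  by rewrite !addKn; apply/same_blockP; exists E.
case=> [/same_blockP[E [Es xE yE]]|st].
  by exists E; split=> //; apply/fsetUP; left.
have [x0 y0] := same_block_gt0 st; have [E [Et xE yE]] := same_blockP _ _ _ st.
exists (translate n E); split.
- by apply/fsetUP; right; apply: in_imfset.
- by apply/imfsetP; exists (x - n)%N => //=; lia.
- by apply/imfsetP; exists (y - n)%N => //=; lia.
Qed.

Lemma mem_ground_stip (s : stip) x :
  (x \in ground s) = (0 < x <= #|` ground s|)%N.
Proof. by rewrite {1}ground_stip mem_itv. Qed.

Lemma same_block_stip_le (s : stip) x y : same_block s x y ->
  (0 < x <= #|` ground s|)%N /\ (0 < y <= #|` ground s|)%N.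
Proof. by case/same_block_ground; rewrite !mem_ground_stip. Qed.

Lemma card_bullet (s t : stip) :
  #|` ground (bullet s t)| = (#|` ground s| + #|` ground t|)%N.
Proof. by rewrite ground_bullet card_itv subn1. Qed.

Lemma ip_le_card (I J : ip) : ip_le I J -> #|` ground I| = #|` ground J|.
Proof. by case/ip_leP => ->. Qed.

(** Equal sizes of [a] and [u] put both boundaries at the same place, so the order can be tested on
    each side separately. *)
Lemma ip_le_bullet (a b u v : stip) : #|` ground a| = #|` ground u| ->
  ip_le (bullet a b) (bullet u v) = ip_le a u && ip_le b v.
Proof.
move=> au; apply/idP/andP.
  move=> /[dup] /ip_le_card; rewrite !card_bullet au => /addnI bv /ip_leP[_ H].
  split; apply/ip_leP; split; rewrite 1?ground_stip ?au ?bv -1?ground_stip //.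
    move=> x y xy; have := H x y; rewrite !same_block_bullet xy => /(_ isT).
    have [/andP[x0 xa] /andP[y0 ya]] := same_block_stip_le xy.
    case/orP => // /same_block_gt0[]; lia.
  move=> x y xy; have := H (#|` ground u| + x)%N (#|` ground u| + y)%N.
  rewrite !same_block_bullet au !addKn xy orbT => /(_ isT) /orP[] //.
  have [/andP[x0 _] /andP[y0 _]] := same_block_stip_le xy.
  by case/same_block_stip_le; lia.
case=> /ip_leP[ga ha] /ip_leP[gb hb]; apply/ip_leP; split.
  by rewrite !ground_bullet ga gb.
by move=> x y; rewrite !same_block_bullet au => /orP[/ha->//|/hb->]; rewrite orbT.
Qed.

(** The equality is read as two opposite inequalities, each of which splits into factors;
    antisymmetry then applies to each factor. *)
Lemma bullet_inj (a b a' b' : stip) : #|` ground a| = #|` ground a'| ->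
  bullet a b = bullet a' b' -> a = a' /\ b = b'.
Proof.
move=> aa e.
have refl (I : ip) : ip_le I I by apply/ip_leP.
have := refl (bullet a b); rewrite {2}e ip_le_bullet // => /andP[le1 le2].
have := refl (bullet a b); rewrite {1}e ip_le_bullet // => /andP[le3 le4].
by split; apply/val_inj/ip_le_anti.
Qed.

(** * Splitting a partition that lies below a join *)

(** On an interval starting at [n.+1], [rank] is subtraction of [n]. *)
Lemma same_block_std_itv (I : ip) n m x y :
  ground I = itv n.+1 (n + m) ->
  same_block (std I) x y = same_block I (n + x) (n + y).
Proof.
move=> gI.
have fr : {in ground I, (fun z => z - n)%N =1 rank (ground I)}.
  apply: rank_uniq.
    by move=> u v; rewrite gI !mem_itv; lia.
  rewrite gI card_itv; apply/fsetP => k; rewrite mem_itv.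
  apply/imfsetP/idP => /= [[z]|km]; first by rewrite mem_itv; lia.
  by exists (n + k)%N; rewrite ?mem_itv; lia.
have gs : ground (std I) = itv 1 m.
  by rewrite ground_std_blocks gI card_itv; congr itv; lia.
have [/andP[xI yI]|H] := boolP ((n + x \in ground I) && (n + y \in ground I))%N.
  by rewrite -[RHS]same_block_std // -!fr //= !addKn.
transitivity false; [|symmetry]; last first.
  by apply: contraNF H => /same_block_ground[-> ->].
apply: contraNF H => /same_block_ground[].
by rewrite gs gI !mem_itv; lia.
Qed.

(** Every block of [s] lies in a block of [bullet u v], so none crosses the boundary after [n], the
    size of [u]. Hence the standardized restrictions of [s] to the two sides join to [s] again. *)
Lemma bullet_split (s u v : stip) : ip_le s (bullet u v) ->
  exists a b, bullet a b = s /\ #|` ground a| = #|` ground u|.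
Proof.
move=> le; have gs := ip_le_card le; rewrite card_bullet in gs.
case/ip_leP: le => _ H; set n := #|` ground u| in H gs *.
set m := #|` ground v| in gs.
have mem_s x : x \in ground s = (0 < x <= n + m)%N by rewrite mem_ground_stip gs.
have gr k l : (0 < k)%N -> (l <= n + m)%N -> ground (restr s (itv k l)) = itv k l.
  move=> k0 lm; rewrite ground_restr ?mem_itv; last by lia.
  by apply/fsetP => x; rewrite inE mem_s !mem_itv; lia.
have ga : ground (restr s (itv 1 n)) = itv 1 (0 + n) by rewrite gr ?leq_addr.
have gb : ground (restr s (itv n.+1 (n + m))) = itv n.+1 (n + m) by rewrite gr.
have ca : #|` ground (std (restr s (itv 1 n)))| = n.
  by rewrite ground_std_blocks ga !card_itv; lia.
exists (std (restr s (itv 1 n))), (std (restr s (itv n.+1 (n + m)))); split=> //.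
apply/val_inj/same_block_inj => x y; rewrite same_block_bullet ca.
rewrite (same_block_std_itv _ _ ga) (same_block_std_itv _ _ gb) !add0n.
apply/orP/idP => [[/same_block_restr[]//|]|xy].
  move=> /[dup] /same_block_ground[]; rewrite gb !mem_itv => xn yn.
  by rewrite !subnKC; [case/same_block_restr|lia|lia].
have [/andP[x0 xs] /andP[y0 ys]] := same_block_stip_le xy.
(* The bound [bullet u v] puts both points on the same side of the boundary, together with
   everything between them. *)
have := H x y xy; rewrite same_block_bullet => /orP[/same_block_stip_le|/same_block_gt0].
  move=> [/andP[_ xn] /andP[_ yn]]; left; apply/same_block_restr; split=> // z.
  by rewrite mem_itv; lia.
move=> [xn yn]; right; rewrite !subnKC; [|lia|lia].
by apply/same_block_restr; split=> // z; rewrite mem_itv; lia.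
Qed.

(** * Restriction of a joined partition *)

Lemma mem_translate n (A : {fset nat}) x :
  (x \in translate n A) = (n <= x)%N && ((x - n)%N \in A).
Proof.
apply/imfsetP/andP => /= [[y yA ->]|[nx xA]].
  by rewrite leq_addr addKn.
by exists (x - n)%N; rewrite ?subnKC.
Qed.

(* No block of [bullet L M] meets both [L] and the translate of [M], so a clique
   of the joined set that runs across the boundary is cut there. *)
Lemma std_restr_bullet (L M : stip) (A B : {fset nat}) :
  A `<=` ground L -> B `<=` ground M ->
  std (restr (bullet L M) (A `|` translate #|` ground L| B))
  = bullet (std (restr L A)) (std (restr M B)).
Proof.
move=> /[dup] AsL /fsubsetP AL /[dup] BsM /fsubsetP BM.
set l := #|` ground L|; set W := restr (bullet L M) _.
have A_le x : x \in A -> (0 < x <= l)%N by move/AL; rewrite mem_ground_stip.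
have B_le x : x \in B -> (0 < x <= #|` ground M|)%N.
  by move/BM; rewrite mem_ground_stip.
have A0 : 0%N \notin A by apply/negP => /A_le.
have B0 : 0%N \notin B by apply/negP => /B_le.
have gA : ground (restr L A) = A by rewrite ground_restr //; apply/fsetIidPl.
have gB : ground (restr M B) = B by rewrite ground_restr //; apply/fsetIidPl.
(* Each side of [l] sees only one of the two sets; [B0] rules out the value 0 that [x - l] takes
   when [x <= l]. *)
have inG x : (x \in A `|` translate l B) =
             if (x <= l)%N then x \in A else (x - l)%N \in B.
  rewrite inE mem_translate; case: (leqP x l) => xl.
    have -> : (x - l = 0)%N by lia.
    by rewrite (negbTE B0) andbF orbF.
  rewrite (ltnW xl) orb_idl // => /A_le; lia.
have gW x : (x \in ground W) =
             if (x <= l)%N then x \in A else (x - l)%N \in B.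
  rewrite /W ground_restr; last by rewrite inG.
  rewrite -inG inE ground_bullet andb_idr // inG mem_itv -/l.
  by case: (leqP x l) => xl; [move/A_le|move/B_le]; lia.
have [p iA] : exists p, rank A @` A = itv 1 p by exists #|` A|; apply: rank_image.
have [q iB] : exists q, rank B @` B = itv 1 q by exists #|` B|; apply: rank_image.
have rA x : x \in A -> (0 < rank A x <= p)%N.
  by move=> xA; rewrite -mem_itv -iA in_imfset.
have rB x : x \in B -> (0 < rank B x <= q)%N.
  by move=> xB; rewrite -mem_itv -iB in_imfset.
have cA : #|` ground (std (restr L A))| = p.
  by rewrite ground_std_blocks gA -rank_image iA card_itv subn1.
have cB : #|` ground (std (restr M B))| = q.
  by rewrite ground_std_blocks gB -rank_image iB card_itv subn1.
(* The concatenation of the two rank bijections: the ranks in [B] are shifted by [p], the size of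
   [A]. *)
apply: (@std_eq _ _
  (fun x => if x <= l then rank A x else p + rank B (x - l))%N).
- move=> x y; rewrite !gW; case: (leqP x l) => xl; case: (leqP y l) => yl xW yW.
  + by rewrite rank_mono.
  + have := rA _ xW; have := rB _ yW; lia.
  + have := rA _ yW; have := rB _ xW; lia.
  + by rewrite leq_add2l rank_mono //; lia.
- rewrite ground_bullet cA cB; apply/fsetP => k; rewrite mem_itv.
  apply/idP/imfsetP => /= [kk|[x]]; last first.
    by rewrite gW; case: (leqP x l) => xl xW ->; [have := rA _ xW|have := rB _ xW]; lia.
  case: (leqP k p) => /= kA.
    have : k \in rank A @` A by rewrite iA mem_itv; lia.
    case/imfsetP => x /= xA ->; exists x; have := A_le _ xA.
      by rewrite gW; case: (leqP x l) => //; lia.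
    by case: (leqP x l) => //; lia.
  have : (k - p)%N \in rank B @` B by rewrite iB mem_itv; lia.
  case/imfsetP => x /= xB kx; have := B_le _ xB => xm; exists (l + x)%N.
    by rewrite gW addKn xB; case: (leqP (l + x) l) => //; lia.
  by rewrite addKn -kx; case: (leqP (l + x) l) => //; lia.
- move=> x y xW yW; rewrite /W same_block_bullet cA.
  have sA u v : u \in A -> v \in A ->
      same_block (std (restr L A)) (rank A u) (rank A v) = same_block (restr L A) u v.
    by have := @same_block_std (restr L A) u v; rewrite gA; apply.
  have sB u v : u \in B -> v \in B ->
      same_block (std (restr M B)) (rank B u) (rank B v) = same_block (restr M B) u v.
    by have := @same_block_std (restr M B) u v; rewrite gB; apply.
  move: xW yW; rewrite !gW.
  case: (leqP x l) => xl; case: (leqP y l) => yl xW yW.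
  + rewrite sA //; have := rA _ xW; have := rA _ yW => ry rx.
    have -> : (rank A x - p = 0)%N by lia.
    transitivity (same_block (restr L A) x y).
      by rewrite orb_idr // => /same_block_gt0[].
    apply/idP/idP => /same_block_restr[xy H]; apply/same_block_restr; split.
    * by rewrite same_block_bullet xy.
    * move=> z zz; rewrite inG; case: (leqP z l) => zl; [exact: H|lia].
    * move: xy; rewrite same_block_bullet => /orP[] // /same_block_gt0[]; lia.
    * move=> z zz; have := H z zz; rewrite inG; case: (leqP z l) => // zl; lia.
  (* For points on opposite sides both relations are false: the ranks are separated by [p] just as
     the points are by [l]. *)
  + have := rA _ xW; have := rB _ yW => ry rx.
    transitivity false; [apply/negbTE/negP|apply/esym/negbTE/negP].
      case/orP=> [/same_block_stip_le|/same_block_gt0[]]; rewrite ?cA; lia.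
    case/same_block_restr; rewrite same_block_bullet => /orP[/same_block_stip_le|/same_block_gt0[]]; lia.
  + have := rB _ xW; have := rA _ yW => ry rx.
    transitivity false; [apply/negbTE/negP|apply/esym/negbTE/negP].
      case/orP=> [/same_block_stip_le|/same_block_gt0[]]; rewrite ?cA; lia.
    case/same_block_restr; rewrite same_block_bullet => /orP[/same_block_stip_le|/same_block_gt0[]]; lia.
  + rewrite !addKn sB //; have := rB _ xW; have := rB _ yW => ry rx.
    transitivity (same_block (restr M B) (x - l) (y - l)).
      by rewrite orb_idl // => /same_block_stip_le[]; rewrite cA; lia.
    apply/idP/idP => /same_block_restr[xy H]; apply/same_block_restr; split.
    * by rewrite same_block_bullet xy orbT.
    * move=> z zz; rewrite inG; case: (leqP z l) => zl; [lia|apply: H; lia].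
    * by move: xy; rewrite same_block_bullet => /orP[] // /same_block_stip_le[]; lia.
    * move=> z zz; have := H (l + z)%N; rewrite inG addKn.
      case: (leqP (l + z) l) => zl; last by apply; lia.
      lia.
Qed.

(** * Counting subsets and decompositions *)

Lemma big_fpowerset_bullet (R : nmodType) (L M : stip) (F : {fset nat} -> R) :
  (\sum_(C <- fpowerset (ground (bullet L M))) F C =
   \sum_(A <- fpowerset (ground L)) \sum_(B <- fpowerset (ground M))
     F (A `|` translate #|` ground L| B))%R.
Proof.
set l := #|` ground L|.
(* The double sum becomes a sum over the list of all unions, which is then shown to enumerate the
   power set without repetition. *)
rewrite -(big_allpairs_dep (h := fun A B => A `|` translate l B) (F := F)).
have inL (A : {fset nat}) x : A `<=` ground L -> x \in A -> (0 < x <= l)%N.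
  by move=> /fsubsetP AL /AL; rewrite mem_ground_stip.
have inM (B : {fset nat}) x : B `<=` ground M -> x \in B -> (0 < x)%N.
  by move=> /fsubsetP BM /BM; rewrite mem_ground_stip => /andP[].
apply: perm_big; apply: uniq_perm; first exact: fset_uniq.
  apply: allpairs_uniq; [exact: fset_uniq|exact: fset_uniq|].
  move=> _ _ /allpairsP[[A B] /= [AL BM ->]] /allpairsP[[A' B'] /= [AL' BM' ->]].
  rewrite !fpowersetE in AL BM AL' BM' => /fsetP e.
  congr pair; apply/fsetP => x.
    have := e x; rewrite /= !inE !mem_translate.
    have [xl|lx] := leqP x l.
      have -> : (x - l = 0)%N by lia.
      have nM (B0 : {fset nat}) : B0 `<=` ground M -> 0%N \in B0 = false.
        by move=> sB; apply/negP => /(inM _ _ sB).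
      by rewrite !nM // !andbF !orbF.
    by move=> _; apply/idP/idP => /inL-/(_ ltac:(assumption)); lia.
  have := e (l + x)%N; rewrite /= !inE !mem_translate leq_addr addKn /=.
  (* The case [x = 0] is separate: [l + 0] may belong to the left part, but 0 belongs to neither [B]
     nor [B']. *)
  have [->|x0] := posnP x.
    by move=> _; apply/idP/idP => /inM-/(_ ltac:(assumption)).
  have nA (A0 : {fset nat}) : A0 `<=` ground L -> (l + x \in A0)%N = false.
    by move=> s; apply/negbTE/negP => /(inL _ _ s); lia.
  by rewrite !nA.
move=> C; rewrite fpowersetE; apply/idP/allpairsP.
  move=> /fsubsetP CLM.
  have Cm x : x \in C -> (0 < x <= l + #|` ground M|)%N.
    by move/CLM; rewrite ground_bullet mem_itv.
  (* The part of [C] up to [l], and the part beyond [l] shifted back; ranging over [ground M] keeps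
     0 out of the second set. *)
  exists ([fset x in C | x <= l]%N, [fset x in ground M | (l + x)%N \in C]).
  rewrite !fpowersetE /=; split.
  - by apply/fsubsetP => x; rewrite !inE /= mem_ground_stip => /andP[/Cm]; lia.
  - by apply/fsubsetP => x; rewrite !inE => /andP[].
  - apply/fsetP => x; rewrite inE mem_translate !inE /= mem_ground_stip.
    have [xl|lx] := leqP x l.
      by rewrite andbT orb_idr // => /and3P[]; lia.
    rewrite andbF (ltnW lx) subnKC ?(ltnW lx) //=; rewrite andb_idl // => /Cm /=; lia.
case=> -[A B] /= [+ + ->]; rewrite !fpowersetE => AL BM.
rewrite ground_bullet_blocks; apply: fsetUSS => //.
by apply/fsubsetP => x; rewrite !mem_translate => /andP[-> /(fsubsetP BM)].
Qed.

(** At most one term of the sum is nonzero, since [a] below [u] fixes the size of [a] and thereby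
    the decomposition of [s]. [bullet_split] provides that decomposition when [s] lies below the
    join. *)
Lemma count_bullet_fiber (s u v : stip) :
  (ip_le s (bullet u v) : nat) =
  (\sum_(p <- bullet_fiber s) (ip_le p.1 u && ip_le p.2 v))%N.
Proof.
have [le|nle] := boolP (ip_le s (bullet u v)).
  have [a [b [e au]]] := bullet_split le.
  have ab : (a, b) \in bullet_fiber s by rewrite mem_bullet_fiber e.
  rewrite (bigD1_seq (a, b)) ?fset_uniq //= big1_seq ?addn0.
    by rewrite -ip_le_bullet // e le.
  case=> a' b' /= /andP[ne]; rewrite mem_bullet_fiber -e => /eqP e'.
  apply/eqP; rewrite eqb0; apply: contra ne => /andP[/ip_le_card a'u _].
  by have [|-> ->] := bullet_inj _ e'; rewrite ?a'u ?au.
rewrite big1_seq // => -[a b] /=; rewrite mem_bullet_fiber => /eqP e.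
apply/eqP; rewrite eqb0; apply: contra nle => /andP[le1 le2].
by rewrite -e ip_le_bullet ?le1 // (ip_le_card le1).
Qed.

Local Open Scope ring_scope.

Lemma card_fset_cond (K : choiceType) (X : {fset K}) (P : pred K) :
  #|` [fset x in X | P x]| = (\sum_(x <- X) P x)%N.
Proof.
by rewrite card_fset_sum1 -big_fset_condE /= -big_mkcond.
Qed.

Lemma IPC_basis (L s : stip) :
  IPC L << s >> = \sum_(A <- fpowerset (ground L)) (ip_le s (std (restr L A)))%:R.
Proof. by rewrite /= liftU scale1r card_fset_cond natr_sum. Qed.

Theorem theorem3p46 (s L M : stip) :
  IPC (bullet L M) << s >> =
  functional_tensor (IPC L) (IPC M) (coproduct << s >>).
Proof.
have -> : coproduct << s >> = \sum_(p <- bullet_fiber s) tensor << p.1 >> << p.2 >>.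
  by rewrite /= liftU scale1r.
rewrite linear_sum IPC_basis big_fpowerset_bullet.
under [RHS]eq_bigr => p _ do
  rewrite functional_tensorE !IPC_basis mulr_suml.
(* The sum over the fiber moves inside those over [A] and then [B], leaving [count_bullet_fiber] for
   fixed subsets; [big_seq] retains the inclusions that [std_restr_bullet] requires. *)
rewrite [RHS]exchange_big [LHS]big_seq [RHS]big_seq.
apply: eq_bigr => A; rewrite fpowersetE => AL.
under [RHS]eq_bigr => p _ do rewrite mulr_sumr.
rewrite [RHS]exchange_big [LHS]big_seq [RHS]big_seq.
apply: eq_bigr => B; rewrite fpowersetE => BM.
rewrite std_restr_bullet // count_bullet_fiber natr_sum.
by apply: eq_bigr => p _; rewrite -natrM mulnb.
Qed.
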